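(* Let $T$ be a bounded operator on a complex Banach space $X$ such that the subspaces of finite codimension in $\mathrm{Lat}(T)$ are linearly ordered by inclusion, and their intersection $X_{\omega}$ is non-zero. Let $A$ be the Banach algebra of operators on $X$ generated by $T$, and let $\mathcal{L}=A\oplus^{\mathrm{id}}X$. Then the intersection of all closed Lie subalgebras of finite codimension in $\mathcal{L}$ is non-zero, while the Frattini radical is trivial: $$P_{\mathfrak{S}}(\mathcal{L})\neq\mathcal{F}(\mathcal{L})=\{0\}.$$
   Context: $\mathrm{Lat}(T)$ is the lattice of all closed subspaces of $X$ invariant for $T$. $A$ is the norm-closed subalgebra of $\mathcal{B}(X)$ generated by $T$, regarded as a (commutative) Banach Lie algebra of operators. A Banach Lie algebra is a complex Lie algebra $\mathcal{L}$ which is a Banach space in a norm such that, for some $t_{\mathcal{L}}>0$, $\|[a,b]\|\leq t_{\mathcal{L}}\|a\|\|b\|$ for all $a,b\in\mathcal{L}$. The semidirect product $A\oplus^{\mathrm{id}}X$ is the space of pairs $(a;x)$, $a\in A$, $x\in X$, with norm $\max\{\|a\|,\|x\|\}$ and bracket $[(a;x),(b;y)]=([a,b];\,ay-bx)$, $[a,b]=ab-ba$. $P_{\mathfrak{S}}(\mathcal{L})$ is the intersection of all proper closed Lie subalgebras of finite codimension in $\mathcal{L}$, and $P_{\mathfrak{S}}(\mathcal{L})=\mathcal{L}$ if there are none; it is a closed Lie ideal. Put $P_{\mathfrak{S}}^{0}(\mathcal{L})=\mathcal{L}$, $P_{\mathfrak{S}}^{\alpha+1}(\mathcal{L})=P_{\mathfrak{S}}(P_{\mathfrak{S}}^{\alpha}(\mathcal{L}))$,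 $P_{\mathfrak{S}}^{\alpha}(\mathcal{L})=\bigcap_{\alpha'<\alpha}P_{\mathfrak{S}}^{\alpha'}(\mathcal{L})$ for limit ordinals $\alpha$. The Frattini radical $\mathcal{F}(\mathcal{L})$ is the value at which this decreasing transfinite sequence of closed Lie ideals stabilizes. (The same $\mathcal{F}$ is obtained if subalgebras are replaced by ideals.) *)

(* Defs.v *)
From HB Require Import structures.
From mathcomp Require Import all_boot all_order all_algebra.
From mathcomp Require Import complex wochoice ring.
From mathcomp Require Import all_classical all_reals all_analysis.
Set Implicit Arguments.
Unset Strict Implicit.
Unset Printing Implicit Defensive.
Import Order.TTheory GRing.Theory Num.Theory.
Import numFieldNormedType.Exports.
Local Open Scope classical_set_scope.
Local Open Scope complex_scope.
Local Open Scope ring_scope.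

(* [bop X] is B(X), the bounded operators on X, with the operator norm.       *)
Definition is_bop {R : realType} {X : normedModType R[i]} : {pred X -> X} :=
  [pred f : X -> X | `[< linear f /\ continuous f >]].

Record bop {R : realType} (X : normedModType R[i]) := Bop {
  bop_fun :> X -> X; _ : bop_fun \in is_bop }.

Section bop_structure.
Context {R : realType} {X : normedModType R[i]}.
Implicit Types (f g : bop X) (x : X).

HB.instance Definition _ := [isSub for @bop_fun R X].
HB.instance Definition _ := [Choice of bop X by <:].

Lemma bop_submod_closed : submod_closed (@is_bop R X).
Proof.
split=> [|a f g /asboolP[fl fc] /asboolP[gl gc]]; apply/asboolP.
  by split=> [k x y|x]; [rewrite /= scaler0 addr0|exact: cvg_cst].
split=> [k x y|x].
  rewrite -[LHS]/(a *: f (k *: x + y) + g (k *: x + y)).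
  rewrite -[RHS]/(k *: (a *: f x + g x) + (a *: f y + g y)).
  by rewrite fl gl !scalerDr !scalerA (mulrC a) addrACA.
by apply: cvgD; [apply: cvgZr; exact: fc|exact: gc].
Qed.

HB.instance Definition _ :=
  GRing.isSubmodClosed.Build _ _ (@is_bop R X) bop_submod_closed.
HB.instance Definition _ := [SubChoice_isSubLmodule of bop X by <:].

Lemma bop_linear f : linear f. Proof. by have /asboolP[] := valP f. Qed.
HB.instance Definition _ f :=
  GRing.isLinear.Build R[i] X X *:%R (bop_fun f) (bop_linear f).

Lemma bop_continuous f : continuous f.
Proof. by have /asboolP[] := valP f. Qed.

Lemma bopP f g : f =1 g <-> f = g.
Proof. by split=> [fg|->//]; apply/val_inj/funext. Qed.

(* The norm of a normed module over R[i] takes values in R[i]; the supremum   *)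
(* is taken in R and injected back.                                           *)
Definition opnorm f : R[i] :=
  (sup [set complex.Re `|f x| | x in [set x : X | `|x| <= 1]])%:C.

Lemma bop_bounded f : exists2 M : R, 0 <= M & forall x, `|f x| <= M%:C * `|x|.
Proof.
have /linear_boundedP : bounded_near f (nbhs 0).
  by apply/linear_bounded_continuous; exact: bop_continuous.
case=> r [rr /(_ (`|r| + 1))]; have hr : r < `|r| + 1.
  by rewrite (le_lt_trans (real_ler_norm rr))// ltrDl.
move=> /(_ hr) hF; have r0 : 0 <= `|r| + 1 by rewrite addr_ge0.
exists (complex.Re (`|r| + 1)).
  by move: r0; rewrite lecE => /andP[].
move=> x; rewrite RRe_real ?ger0_real//; exact: hF.
Qed.


Lemma ReK_norm (V : normedModType R[i]) (x : V) :
  (complex.Re `|x|)%:C = `|x|.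
Proof. by rewrite RRe_real// normr_real. Qed.

Lemma opnorm_has_sup f :
  has_sup [set complex.Re `|f x| | x in [set x : X | `|x| <= 1]].
Proof.
split; first by exists (complex.Re `|f 0|), 0 => //=; rewrite normr0.
have [M M0 fM] := bop_bounded f; exists M => _ [x /= x1 <-].
rewrite -lecR ReK_norm (le_trans (fM x))//.
by rewrite -[leRHS]mulr1 ler_wpM2l// ler0c.
Qed.

Lemma opnorm_ler f x : `|f x| <= opnorm f * `|x|.
Proof.
have [->|x0] := eqVneq x 0.
  by rewrite linear0 !normr0 mulr0.
rewrite -ler_pdivrMr ?normr_gt0//.
have -> : `|f x| / `|x| = `|f (`|x|^-1 *: x)|.
  by rewrite linearZ normrZ normfV normr_id mulrC.
rewrite -ReK_norm lecR; apply: sup_upper_bound; first exact: opnorm_has_sup.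
by exists (`|x|^-1 *: x) => //=; rewrite normrZ normfV normr_id mulVf ?normr_eq0.
Qed.

Lemma opnorm_le f (M : R[i]) : (forall x, `|x| <= 1 -> `|f x| <= M) ->
  opnorm f <= M.
Proof.
move=> fM; have M0 : 0 <= M.
  by rewrite (le_trans _ (fM 0 _))// normr0.
rewrite -(RRe_real (ger0_real M0)) lecR.
apply: ge_sup; first by have [] := opnorm_has_sup f.
by move=> _ [x /= x1 <-]; rewrite -lecR ReK_norm RRe_real ?ger0_real// fM.
Qed.

Lemma opnorm_ge0 f : 0 <= opnorm f.
Proof.
rewrite ler0c; apply: (@le_trans _ _ (complex.Re `|f 0|)).
  by rewrite -ler0c ReK_norm.
apply: sup_upper_bound; first exact: opnorm_has_sup.
by exists 0 => //=; rewrite normr0.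
Qed.

Lemma opnorm_ler1 f x : `|x| <= 1 -> `|f x| <= opnorm f.
Proof.
move=> x1; rewrite (le_trans (opnorm_ler f x))//.
by rewrite -[leRHS]mulr1 ler_wpM2l// opnorm_ge0.
Qed.

Lemma opnormD f g : opnorm (f + g) <= opnorm f + opnorm g.
Proof.
apply: opnorm_le => x x1; rewrite (le_trans (ler_normD (f x) (g x)))//.
by rewrite lerD// opnorm_ler1.
Qed.

Lemma opnormZ (l : R[i]) f : opnorm (l *: f) = `|l| * opnorm f.
Proof.
have le (k : R[i]) h : opnorm (k *: h) <= `|k| * opnorm h.
  apply: opnorm_le => x x1; rewrite [X in `|X|](_ : _ = k *: h x)// normrZ.
  by rewrite ler_wpM2l// opnorm_ler1.
apply/eqP; rewrite eq_le le/=.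
have [->|l0] := eqVneq l 0; first by rewrite normr0 mul0r opnorm_ge0.
rewrite -ler_pdivlMl ?normr_gt0//.
by have := le l^-1 (l *: f); rewrite scalerA mulVf// scale1r normfV.
Qed.

Lemma opnorm0_eq0 f : opnorm f = 0 -> f = 0.
Proof.
move=> f0; apply/bopP => x; apply/eqP.
by rewrite -normr_le0 (le_trans (opnorm_ler f x))// f0 mul0r.
Qed.

HB.instance Definition _ := @Lmodule_isNormed.Build R[i] (bop X)
  opnorm opnormD opnormZ opnorm0_eq0.

Lemma bop_comp_subproof f g : (f \o g : X -> X) \in is_bop.
Proof.
apply/asboolP; split=> [k x y|x] /=; first by rewrite !bop_linear.
by apply: continuous_comp; exact: bop_continuous.
Qed.
Definition bop_comp f g : bop X := Bop (bop_comp_subproof f g).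

End bop_structure.

Section bop_complete.
Context {R : realType} {X : completeNormedModType R[i]}.

Lemma bop_complete (F : set_system (bop X)) :
  ProperFilter F -> cauchy F -> cvg F.
Proof.
move=> FF /cauchy_ballP Fc.
have Fcx (e : R[i]) : 0 < e -> exists2 A, F A &
    forall f g, A f -> A g -> forall x, `|f x - g x| <= e * `|x|.
  move=> e0; have [[A B] /= [FA FB] AB] := Fc _ e0.
  exists (A `&` B); first exact: filterI.
  move=> f g [Af _] [_ Bg] x; have := AB (f, g) (conj Af Bg).
  rewrite /= -ball_normE /= => /ltW fg.
  by rewrite (le_trans (opnorm_ler (f - g) x))// ler_wpM2r.
pose Fx (x : X) : set_system X := (fun f : bop X => f x) @ F.
have cvx x : cvg (Fx x).
  apply: cauchy_cvg; apply/cauchy_ballP => e e0.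
  have d0 : 0 < e / (`|x| + 1) by rewrite divr_gt0// ltr_wpDl.
  have [A FA hA] := Fcx _ d0.
  exists ([set f x | f in A], [set f x | f in A]) => /=.
    by split; apply: (@filterS _ F _ A) => // f Af; exists f.
  move=> [_ _] [/= [f Af <-] [g Ag <-]]; rewrite -ball_normE /=.
  rewrite (le_lt_trans (hA _ _ Af Ag x))// mulrAC ltr_pdivrMr ?ltr_wpDl//.
  by rewrite ltr_pM2l// ltrDl.
pose g x := lim (Fx x).
have gl : linear g.
  move=> k x y.
  suff : Fx (k *: x + y) --> k *: g x + g y by exact: cvg_lim.
  have -> : Fx (k *: x + y) = (fun f : bop X => k *: f x + f y) @ F.
    by rewrite /Fx; congr (_ @ F); apply/funext => f; rewrite bop_linear.
  by apply: cvgD; [apply: cvgZr|]; exact: cvx.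
have gE (e : R[i]) A : F A -> 0 < e ->
    (forall f h, A f -> A h -> forall x, `|f x - h x| <= e * `|x|) ->
    forall f x, A f -> `|f x - g x| <= e * `|x|.
  move=> FA e0 hA f x Af.
  apply/ler_addgt0Pr => d d0.
  have /cvgrPdist_lt/(_ _ d0) gd : Fx x --> g x by exact: cvx.
  have [h [Ah ghd]] := filter_ex (filterI FA gd).
  rewrite (le_trans (ler_distD (h x) _ _))// lerD ?hA//.
  by rewrite distrC ltW.
have gb : g \in is_bop.
  apply/asboolP; split=> //.
  pose G : {linear X -> X} := HB.pack g (GRing.isLinear.Build _ _ _ _ g gl).
  have [A FA hA] := Fcx 1 ltr01; have [f Af] := filter_ex FA.
  apply: (@bounded_linear_continuous _ _ _ G); apply/linear_boundedP.
  near=> r => x /=; rewrite -[g x](subKr (f x)).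
  rewrite (le_trans (ler_normB _ _))// (@le_trans _ _ ((opnorm f + 1) * `|x|))//.
    rewrite mulrDl lerD ?opnorm_ler//; exact: (gE _ _ FA ltr01 hA).
  rewrite ler_wpM2r//; near: r; apply: nbhs_pinfty_ge.
  by rewrite ger0_real// addr_ge0// opnorm_ge0.
apply/cvg_ex; exists (Bop gb); apply/cvgrPdist_le => e e0.
have [A FA hA] := Fcx _ e0.
apply: (@filterS _ F _ A) => // f Af; rewrite distrC; apply: opnorm_le => x x1.
rewrite (le_trans (gE _ _ FA e0 hA f x Af))//.
by rewrite -[leRHS]mulr1 ler_wpM2l// ltW.
Unshelve. all: by end_near. Qed.

HB.instance Definition _ := Uniform_isComplete.Build (bop X) bop_complete.
End bop_complete.

HB.mixin Record isBanachLie (R : realType) L & CompleteNormedModule R[i] L := {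
  lie : L -> L -> L;
  lie_linearl : forall z : L, linear (fun x => lie x z);
  lie_linearr : forall z : L, linear (lie z);
  liexx : forall x : L, lie x x = 0;
  lie_jacobi : forall x y z : L,
    lie x (lie y z) + lie y (lie z x) + lie z (lie x y) = 0;
  lie_bounded : exists2 t : R, 0 < t &
    forall x y : L, `|lie x y| <= t%:C * `|x| * `|y|
}.

#[short(type="banachLieType")]
HB.structure Definition BanachLie (R : realType) :=
  {L of CompleteNormedModule R[i] L & isBanachLie R L}.

(* B(X) (+)^id X, with the library's norm on products, i.e. the max of the   *)
(* two norms. A (+)^id X, for A a Lie algebra of operators, is the part of it *)
(* over A: see [semidirect_over] below.                                       *)
Definition semidirect {R : realType} (X : completeNormedModType R[i]) : Type :=
  (bop X * X)%type.

Section semidirect_structure.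
Context {R : realType} {X : completeNormedModType R[i]}.
Implicit Types u v w : semidirect X.

HB.instance Definition _ := NormedModule.copy (semidirect X) (bop X * X)%type.

Lemma semidirect_complete (F : set_system (semidirect X)) :
  ProperFilter F -> cauchy F -> cvg F.
Proof.
move=> FF /cauchy_ballP Fc.
have c1 : cvg ((fun u : semidirect X => u.1) @ F).
  apply: cauchy_cvg; apply/cauchy_ballP => e e0.
  have [[A B] /= [FA FB] AB] := Fc _ e0.
  exists ([set u.1 | u in A], [set u.1 | u in B]) => /=.
    split; [apply: (@filterS _ F _ A)|apply: (@filterS _ F _ B)] => // u Du;
      by exists u.
  by move=> [_ _] [/= [f Af <-] [g Ag <-]]; have [] := AB (f, g) (conj Af Ag).
have c2 : cvg ((fun u : semidirect X => u.2) @ F).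
  apply: cauchy_cvg; apply/cauchy_ballP => e e0.
  have [[A B] /= [FA FB] AB] := Fc _ e0.
  exists ([set u.2 | u in A], [set u.2 | u in B]) => /=.
    split; [apply: (@filterS _ F _ A)|apply: (@filterS _ F _ B)] => // u Du;
      by exists u.
  by move=> [_ _] [/= [f Af <-] [g Ag <-]]; have [] := AB (f, g) (conj Af Ag).
apply/cvg_ex; exists (lim ((fun u : semidirect X => u.1) @ F),
                      lim ((fun u : semidirect X => u.2) @ F)).
apply/cvg_ballP => e e0.
move: c1 c2 => /cvg_ballP/(_ e e0) c1 /cvg_ballP/(_ e e0); move: c1.
by apply: (@filterS2 _ F) => u u1 u2; split.
Qed.

HB.instance Definition _ :=
  Uniform_isComplete.Build (semidirect X) semidirect_complete.

Definition semidirect_lie u v : semidirect X :=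
  (bop_comp u.1 v.1 - bop_comp v.1 u.1, u.1 v.2 - v.1 u.2).


Lemma semidirect_lieC u v : semidirect_lie u v = - semidirect_lie v u.
Proof.
by rewrite /semidirect_lie; congr pair; rewrite /= opprB.
Qed.

Lemma semidirect_lie_linearl w : linear (fun u => semidirect_lie u w).
Proof.
move=> k u v; congr pair.
  apply/bopP => x.
  rewrite -[LHS]/((k *: u.1 (w.1 x)) + v.1 (w.1 x) - w.1 (k *: u.1 x + v.1 x)).
  rewrite -[RHS]/(k *: (u.1 (w.1 x) - w.1 (u.1 x)) + (v.1 (w.1 x) - w.1 (v.1 x))).
  by rewrite linearP scalerBr opprD addrACA.
rewrite -[LHS]/((k *: u.1 w.2) + v.1 w.2 - w.1 (k *: u.2 + v.2)).
rewrite -[RHS]/(k *: (u.1 w.2 - w.1 u.2) + (v.1 w.2 - w.1 v.2)).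
by rewrite linearP scalerBr opprD addrACA.
Qed.

Lemma semidirect_lie_linearr w : linear (semidirect_lie w).
Proof.
move=> k u v; rewrite ![semidirect_lie w _]semidirect_lieC.
by rewrite semidirect_lie_linearl opprD scalerN.
Qed.

Lemma semidirect_liexx u : semidirect_lie u u = 0.
Proof. by congr pair; rewrite subrr. Qed.

Let zmod_jacobi (V : zmodType) (p q r s t u : V) :
  (p - q - (r - s)) + (r - t - (u - q)) + (u - s - (p - t)) = 0.
Proof.
rewrite !opprB !addrA.
rewrite [LHS](ACl ((1*12)*(2*7)*(3*10)*(4*5)*(6*11)*(8*9)))/=.
by rewrite !subrr !addNr !addr0.
Qed.

Lemma semidirect_lie_jacobi u v w :
  semidirect_lie u (semidirect_lie v w) + semidirect_lie v (semidirect_lie w u)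
    + semidirect_lie w (semidirect_lie u v) = 0.
Proof.
have J (a b c : bop X) x y z :
  (a (b z - c y) - (b (c x) - c (b x))) + (b (c x - a z) - (c (a y) - a (c y)))
   + (c (a y - b x) - (a (b z) - b (a z))) = 0.
  by rewrite (linearB a) (linearB b) (linearB c); exact: zmod_jacobi.
congr pair; last exact: (J u.1 v.1 w.1).
apply/bopP => x; exact: (J u.1 v.1 w.1 (u.1 x) (v.1 x) (w.1 x)).
Qed.

Lemma semidirect_lie_bounded : exists2 t : R, 0 < t &
  forall u v, `|semidirect_lie u v| <= t%:C * `|u| * `|v|.
Proof.
exists 2 => // u v.
have n1 (x : semidirect X) : `|x.1| <= `|x|.
  by rewrite [leRHS]/Num.norm/= comparable_le_max ?real_comparable// lexx.
have n2 (x : semidirect X) : `|x.2| <= `|x|.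
  by rewrite [leRHS]/Num.norm/= comparable_le_max ?real_comparable// lexx orbT.
have n (a b : bop X) (s t z : R[i]) (x y : X) : `|a| <= s -> `|b| <= t ->
    `|x| <= s * z -> `|y| <= t * z -> 0 <= z -> `|a y - b x| <= 2%:C * s * t * z.
  move=> as_ bt xs yt z0.
  have s0 : 0 <= s by rewrite (le_trans _ as_).
  have t0 : 0 <= t by rewrite (le_trans _ bt).
  rewrite (le_trans (ler_normB _ _))//.
  rewrite (_ : 2%:C * s * t * z = s * (t * z) + t * (s * z)); last first.
    by rewrite rmorphMn/=; ring.
  rewrite lerD// (le_trans (opnorm_ler _ _))//.
    by rewrite ler_pM ?opnorm_ge0.
  by rewrite ler_pM ?opnorm_ge0.
rewrite [leLHS]/Num.norm/= comparable_ge_max ?real_comparable//; apply/andP; split.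
  apply: opnorm_le => x x1; rewrite -[leRHS]mulr1.
  apply: (n u.1 v.1 _ _ _ (u.1 x) (v.1 x) (n1 u) (n1 v)); rewrite ?mulr1//.
    exact: le_trans (opnorm_ler1 _ x1) (n1 u).
  exact: le_trans (opnorm_ler1 _ x1) (n1 v).
rewrite -[leRHS]mulr1.
by apply: (n u.1 v.1 _ _ _ u.2 v.2 (n1 u) (n1 v)); rewrite ?mulr1.
Qed.

HB.instance Definition _ := isBanachLie.Build R (semidirect X)
  semidirect_lie_linearl semidirect_lie_linearr semidirect_liexx
  semidirect_lie_jacobi semidirect_lie_bounded.

End semidirect_structure.

Section subspaces.
Context {K : numFieldType} {V : lmodType K}.
Implicit Types M N : set V.

Definition linear_subspace N :=
  N 0 /\ forall (k : K) x y, N x -> N y -> N (k *: x + y).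

(* dim (M / N) is finite: finitely many elements of M span M modulo N *)
Definition finite_codim M N := exists (n : nat) (v : 'I_n -> V),
  (forall i, M (v i)) /\
  forall x, M x -> exists c : 'I_n -> K, N (x - \sum_(i < n) c i *: v i).

End subspaces.

Section transfinite.
Context {I : Type} (le : rel I).

Definition slt (a b : I) := le a b /\ a <> b.
Definition is_first a := forall b, ~ slt b a.
Definition is_succ a b := slt a b /\ forall c, slt a c -> le b c.
Definition is_limit b := ~ is_first b /\ ~ exists a, is_succ a b.

End transfinite.

(* A closed Lie subalgebra M of a Banach Lie algebra L is itself a Banach Lie *)
(* algebra, whose closed Lie subalgebras are the closed Lie subalgebras of L  *)
(* contained in M; the operation P and the Frattini radical are defined for   *)
(* such M, so that P can be iterated.                                         *)
Section Frattini.
Context {R : realType} {L : banachLieType R}.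
Implicit Types M N V : set L.

Definition lie_subalgebra N :=
  linear_subspace N /\ forall x y, N x -> N y -> N (lie x y).

Definition proper_fincodim_subalgebra M : set (set L) :=
  [set N | [/\ N `<=` M, N <> M, closed N, lie_subalgebra N & finite_codim M N]].

(* equal to M when there is no proper closed subalgebra of finite codimension *)
Definition P_sub M : set L :=
  M `&` \bigcap_(N in proper_fincodim_subalgebra M) N.

(* S a = P^a(M) for a in the well-ordered type I, i.e. for all ordinals a     *)
(* below the order type of I                                                  *)
Definition P_sequence M (I : Type) (le : rel I) (S : I -> set L) := [/\
  forall a, is_first le a -> S a = M,
  forall a b, is_succ le a b -> S b = P_sub (S a) &
  forall b, is_limit le b -> S b = \bigcap_(a in [set a | slt le a b]) S a].

(* V is a term P^a(M) at which the transfinite sequence is stationary *)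
Definition P_stable_value M V := exists (I : Type) (le : rel I)
    (S : I -> set L) (a : I),
  [/\ well_order le, P_sequence M le S, S a = V & P_sub V = V].

(* the default value M of xget is irrelevant: for a closed Lie subalgebra M   *)
(* there is exactly one stable value                                          *)
Definition Frattini_radical M : set L := xget M (P_stable_value M).

End Frattini.

Section operators.
Context {R : realType} {X : completeNormedModType R[i]}.
Implicit Types (T : bop X) (A : set (bop X)).

Definition Lat T : set (set X) :=
  [set Y | [/\ closed Y, linear_subspace Y & forall x, Y x -> Y (T x)]].

Definition Lat_fincodim T : set (set X) := Lat T `&` finite_codim setT.

Definition op_subalgebra A :=
  linear_subspace A /\ forall f g, A f -> A g -> A (bop_comp f g).

(* the least norm-closed subalgebra of B(X) containing T; it need not contain *)
(* the identity                                                               *)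
Definition generated_algebra T : set (bop X) :=
  smallest [set A | closed A /\ op_subalgebra A] [set T].

Definition semidirect_over A : set (semidirect X) := [set u | A u.1].

Lemma closed_semidirect_over A : closed A -> closed (semidirect_over A).
Proof.
move=> cA; apply: (closed_comp (f := fun u : semidirect X => u.1)) => // u _.
exact: cvg_fst.
Qed.

Lemma lie_subalgebra_semidirect_over A :
  op_subalgebra A -> lie_subalgebra (semidirect_over A).
Proof.
move=> [[A0 AD] AM]; split; first by split=> // k u v; exact: AD.
move=> u v Au Av; rewrite /semidirect_over/= addrC -scaleN1r.
by apply: AD; exact: AM.
Qed.

Lemma generated_algebra_closed T : closed (generated_algebra T).
Proof. by apply: closed_bigI => A [[]]. Qed.

Lemma generated_algebra_subalgebra T : op_subalgebra (generated_algebra T).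
Proof.
split; first split.
- by move=> A [[_ [[]]]].
- by move=> k f g Tf Tg A AT; case: (AT) => -[_ [[_ +] _]] _; apply;
    [exact: Tf|exact: Tg].
- by move=> f g Tf Tg A AT; case: (AT) => -[_ [_ +]] _; apply;
    [exact: Tf|exact: Tg].
Qed.

End operators.

(* Main.v *)
Require Import Defs.
From HB Require Import structures.
From mathcomp Require Import all_boot all_order all_algebra.
From mathcomp Require Import complex wochoice lra ring.
From mathcomp Require Import all_classical all_reals all_analysis.
Import Order.TTheory GRing.Theory Num.Theory.
Import numFieldNormedType.Exports.
Local Open Scope classical_set_scope.
Local Open Scope complex_scope.
Local Open Scope ring_scope.
Set Implicit Arguments.
Unset Strict Implicit.
Unset Printing Implicit Defensive.

(* Let [L] be the algebra [A] generated by [T], extended by [X]. Since [A] is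
   commutative, every closed subspace of finite codimension of a closed
   subalgebra [V] of [L] that contains the elements of [V] with zero first
   component is a subalgebra; by the Hahn-Banach theorem these subspaces force
   the first components of [P_sub V] to vanish. So [P_sub L] is abelian, all its
   subspaces are subalgebras, and [P_sub (P_sub L)] is zero.

   Conversely, let [N] be a closed subalgebra of finite codimension in [L],
   spanned modulo [N] by [v_1, ..., v_n] with first components [a_1, ..., a_n],
   and let [Y] be the set of [y] with [(0, y)] in [N]. Any [a] in [A] is a
   combination of the [a_i] plus the first component of an element of [N], which
   maps [Y] to itself. So the [y] in [Y] with all [a_i y] in [Y] form an
   invariant subspace, closed and of finite codimension, and [N] contains
   [(0, x)] for all [x] in the intersection of such subspaces. *)

(** * Separation of points by continuous linear functionals *)

Section sublinear_functionals.
Context {R : realType} {V : lmodType R[i]}.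
Implicit Types (p q : V -> R) (x y : V).

(** Sublinearity over the reals. Homogeneity is an inequality here: applied to [c^-1] it yields the
    opposite one. *)
Definition sublinear p := (forall x y, p (x + y) <= p x + p y) /\
  forall c x, 0 < c -> p (c%:C *: x) <= c * p x.

Lemma sublinearZ p c x : sublinear p -> 0 < c -> p (c%:C *: x) = c * p x.
Proof.
move=> [_ pZ] c0; apply/eqP; rewrite eq_le pZ//= -ler_pdivlMl//.
have := pZ c^-1 (c%:C *: x).
by rewrite invr_gt0 scalerA -rmorphM/= mulVf ?gt_eqF// scale1r; apply.
Qed.

Lemma sublinear0 p : sublinear p -> p 0 = 0.
Proof.
by move=> ps; have := @sublinearZ p 2 0 ps (ltr0Sn _ _); rewrite scaler0; lra.
Qed.

Lemma sublinear_oppr p x : sublinear p -> - p (- x) <= p x.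
Proof.
move=> ps; have [pD _] := ps.
by have := pD x (- x); rewrite subrr sublinear0//; lra.
Qed.

(* The largest sublinear functional below [p] with value at most [- p y] at
   [- y]. A minimal sublinear [p] coincides with it for every [y], and so is
   additive. *)
Definition directional_inf p y x :=
  inf [set p (x + t%:C *: y) - t * p y | t in [set t : R | 0 <= t]].

Lemma directional_inf_le p y x t : sublinear p -> 0 <= t ->
  directional_inf p y x <= p (x + t%:C *: y) - t * p y.
Proof.
move=> ps t0; apply: ge_inf; last by exists t.
(* This is a lower bound because [s * p y], the value of [p] at [s y], is at most
   [p (x + s y) + p (- x)]. *)
exists (- p (- x)) => _ [s /= s0 <-].
have [s_eq0|s_neq0] := eqVneq s 0.
  by rewrite s_eq0 scale0r mul0r addr0 subr0; exact: sublinear_oppr.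
rewrite -(@sublinearZ p) ?lt_def ?s_neq0//.
by have := ps.1 (x + s%:C *: y) (- x); rewrite [x + _]addrC addrK; lra.
Qed.

Lemma directional_inf_ge p y x c :
  (forall t, 0 <= t -> c <= p (x + t%:C *: y) - t * p y) ->
  c <= directional_inf p y x.
Proof.
move=> h; apply: lb_le_inf; last by move=> _ [t /= t0 <-]; exact: h.
by exists (p (x + 0%:C *: y) - 0 * p y), 0 => /=.
Qed.

Lemma directional_inf_sublinear p y :
  sublinear p -> sublinear (directional_inf p y).
Proof.
move=> ps; split=> [x x'|c x c0].
  rewrite -lerBlDr; apply: directional_inf_ge => t t0.
  rewrite lerBlDr -lerBlDl; apply: directional_inf_ge => s s0.
  have := directional_inf_le y (x + x') ps (addr_ge0 t0 s0).
  have := ps.1 (x + t%:C *: y) (x' + s%:C *: y).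
  rewrite addrACA -scalerDl -rmorphD/=; lra.
rewrite -ler_pdivrMl//; apply: directional_inf_ge => t t0.
have := directional_inf_le y (c%:C *: x) ps (mulr_ge0 (ltW c0) t0).
rewrite ler_pdivrMl// rmorphM/= -scalerA -scalerDr (sublinearZ _ ps)//.
by rewrite mulrBr mulrA.
Qed.

(** Zorn's lemma for the reversed pointwise order: the pointwise infimum of a non-empty chain of
    sublinear functionals below [p] is again sublinear. *)
Lemma minimal_sublinear p : sublinear p -> exists q,
  [/\ sublinear q, forall x, q x <= p x &
    forall r, sublinear r -> (forall x, r x <= q x) -> r = q].
Proof.
move=> ps; pose S := {q | sublinear q /\ forall x, q x <= p x}.
pose ge (q r : S) := `[< forall x, sval r x <= sval q x >].
have [||||[q [qs qp]] qmin] := @Zorn S ge.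
- by move=> q; apply/asboolP.
- move=> r q s /asboolP qr /asboolP rs; apply/asboolP => x.
  exact: le_trans (rs x) (qr x).
- move=> [q ?] [r ?] /asboolP /= qr /asboolP /= rq.
  apply/eq_exist/funext => x; apply/eqP; rewrite eq_le qr rq//.
- move=> C Ctot.
  have [[q0 Cq0]|C0] := pselect (C !=set0); last first.
    (* The empty chain is bounded by [p] itself. *)
    exists (exist _ p (conj ps (fun x => lexx _))) => s Cs.
    by case: C0; exists s.
  pose m x := inf [set sval q x | q in C].
  have mle (q : S) x : C q -> m x <= sval q x.
    move=> Cq; apply: ge_inf; last by exists q.
    exists (- p (- x)) => _ [r Cr <-].
    have [rs rp] := svalP r.
    by rewrite (le_trans _ (sublinear_oppr _ rs))// lerN2.
  have gem c x : (forall q : S, C q -> c <= sval q x) -> c <= m x.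
    move=> h; apply: lb_le_inf; first by exists (sval q0 x), q0.
    by move=> _ [q Cq <-]; exact: h.
  have ms : sublinear m.
    split=> [x y|c x c0].
      rewrite -lerBlDr; apply: (gem) => q Cq.
      rewrite lerBlDr -lerBlDl; apply: gem => r Cr.
      (* The smaller of [q] and [r], evaluated at [x + y], is at most [q x + r y]. *)
      have [h|h] := Ctot _ _ Cq Cr; move/asboolP in h.
        have [[rD _] _] := svalP r.
        have := mle _ (x + y) Cr; have := rD x y; have := h x; lra.
      have [[qD _] _] := svalP q.
      have := mle _ (x + y) Cq; have := qD x y; have := h y; lra.
    rewrite -ler_pdivrMl//; apply: (gem) => q Cq.
    rewrite ler_pdivrMl//; have [[_ qZ] _] := svalP q.
    exact: le_trans (mle _ _ Cq) (qZ _ _ c0).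
  have mp x : m x <= p x.
    by have [_ /(_ x)] := svalP q0; exact/le_trans/mle.
  exists (exist _ m (conj ms mp)) => q Cq; apply/asboolP => x; exact: mle.
exists q; split=> // r rs rq.
have rp x : r x <= p x by exact: le_trans (rq x) (qp x).
by have /(congr1 sval) := qmin (exist _ r (conj rs rp)) (asboolT rq).
Qed.

Lemma minimal_sublinear_additive p : sublinear p ->
  (forall r, sublinear r -> (forall x, r x <= p x) -> r = p) ->
  forall x y, p (x + y) = p x + p y.
Proof.
move=> ps pmin x y; apply/eqP; rewrite eq_le ps.1/= -lerBrDr.
have pE : directional_inf p y = p.
  apply: pmin => [|z]; first exact: directional_inf_sublinear.
  have := directional_inf_le y z ps (lexx 0).
  by rewrite scale0r addr0 mul0r subr0.
(* The term [t = 1] of the infimum gives [p x <= p (x + y) - p y]. *)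
by have := directional_inf_le y x ps ler01; rewrite pE scale1r mul1r.
Qed.

End sublinear_functionals.

Section functional_separation.
Context {R : realType} {V : normedModType R[i]}.
Implicit Types (p : V -> R) (x y : V).

Lemma Re_normD x y :
  complex.Re `|x + y| <= complex.Re `|x| + complex.Re `|y|.
Proof.
by rewrite -lecR rmorphD/= !ReK_norm ler_normD.
Qed.

Lemma sublinear_norm : sublinear (fun x : V => complex.Re `|x|).
Proof.
split=> [|c x c0]; first exact: Re_normD.
by rewrite -lecR rmorphM/= !ReK_norm normrZ ger0_norm// ler0c ltW.
Qed.

Lemma sublinear_additiveZ p c x : sublinear p ->
  (forall x y, p (x + y) = p x + p y) -> p (c%:C *: x) = c * p x.
Proof.
move=> ps pD; have pN z : p (- z) = - p z.
  by apply/eqP; rewrite -addr_eq0 -pD addNr sublinear0.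
have [c0|c0|->] := ltgtP c 0; last by rewrite scale0r mul0r sublinear0.
  by rewrite -[c]opprK rmorphN scaleNr pN (sublinearZ _ ps) ?oppr_gt0 -?mulNr.
exact: sublinearZ.
Qed.

(** A minimal sublinear functional [p] below the norm is real linear and bounded, and
    [z |-> p z - i p (i z)] is then complex linear with real part [p]. *)
Lemma functional_separation x : x != 0 -> exists phi : {linear V -> R[i]^o},
  continuous phi /\ phi x != 0.
Proof.
move=> x0; have ns := sublinear_norm.
(* Starting from the directional infimum along [x], rather than from the norm, forces
   [p (- x) <= - |x|], hence [p x != 0]. *)
have [p [ps pn pmin]] := minimal_sublinear (directional_inf_sublinear x ns).
have pD := minimal_sublinear_additive ps pmin.
have pZ c z := sublinear_additiveZ c z ps pD.
have pN z : p (- z) = - p z.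
  by have := pZ (-1) z; rewrite rmorphN rmorph1 scaleN1r mulN1r.
have ple z : p z <= complex.Re `|z|.
  apply: le_trans (pn z) _.
  have := directional_inf_le x z ns (lexx 0).
  by rewrite scale0r addr0 mul0r subr0.
have pabs z : `|p z| <= complex.Re `|z|.
  by rewrite ler_norml ple andbT lerNl -pN (le_trans (ple _))// normrN.
have px : p x != 0.
  have := le_trans (pn (- x)) (directional_inf_le x (- x) ns ler01).
  rewrite scale1r addNr normr0 mul1r /= pN sub0r lerN2.
  have : 0 < complex.Re `|x| by rewrite -ltcR ReK_norm normr_gt0.
  by move=> n0 /(lt_le_trans n0)/gt_eqF ->.
pose phi z := p z +i* - p ('i *: z).
have phil : scalar phi.
  move=> [a b] y z.
  rewrite /phi pD scalerDr pD.
  have -> : (a +i* b) *: y = a%:C *: y + b%:C *: ('i *: y).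
    by rewrite scalerA -scalerDl; congr (_ *: _); simpc.
  have -> : 'i *: (a%:C *: y + b%:C *: ('i *: y)) =
      a%:C *: ('i *: y) + (- b)%:C *: y.
    by rewrite scalerDr !scalerA; congr (_ *: _ + _ *: _); simpc.
  by rewrite !pD !pZ; simpc; congr (_ +i* _); ring.
pose Phi : {linear V -> R[i]^o} :=
  HB.pack phi (GRing.isLinear.Build _ _ _ _ phi phil).
exists Phi; split; last by apply: contra px => /eqP[->].
apply: (@bounded_linear_continuous _ _ _ Phi); apply/linear_boundedP.
near=> r => z /=.
have -> : phi z = (p z)%:C + - ('i * (p ('i *: z))%:C).
  by rewrite /phi; simpc.
rewrite (le_trans (ler_normB _ _))// normrM.
have ni : `|'i : R[i]| = 1 by rewrite normc_def /= expr0n expr1n add0r sqrtr1.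
have h w : `|(p w)%:C| <= `|w|.
  by rewrite -ReK_norm normc_def/= expr0n addr0 sqrtr_sqr lecR.
rewrite ni mul1r (@le_trans _ _ (2 * `|z|))//.
  by rewrite mulr_natl mulr2n lerD// (le_trans (h _))// normrZ ni mul1r.
by rewrite ler_wpM2r//; near: r; apply: nbhs_pinfty_ge; rewrite realn.
Unshelve. all: by end_near. Qed.

End functional_separation.

(** * Subspaces of finite codimension *)

Section finite_codimension.
Context {K : numFieldType}.

Lemma linear_subspace_sum {V : lmodType K} (N : set V) n (c : 'I_n -> K)
  (v : 'I_n -> V) : linear_subspace N -> (forall i, N (v i)) ->
  N (\sum_(i < n) c i *: v i).
Proof.
move=> [N0 ND] Nv; elim/big_ind: _ => [//|x y Nx Ny|i _].
  by rewrite -[x]scale1r; exact: ND.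
by rewrite -[_ *: _]addr0; exact: ND.
Qed.

Lemma linear_subspaceB {V : lmodType K} (N : set V) x y :
  linear_subspace N -> N x -> N y -> N (x - y).
Proof. by move=> [_ ND] Nx Ny; rewrite addrC -scaleN1r; exact: ND. Qed.

Lemma linear_subspaceI {V : lmodType K} (M N : set V) :
  linear_subspace M -> linear_subspace N -> linear_subspace (M `&` N).
Proof.
move=> [M0 MD] [N0 ND]; split=> // k x y [Mx Nx] [My Ny].
by split; [exact: MD|exact: ND].
Qed.

Lemma linear_subspace_preimage {V W : lmodType K} (f : {linear V -> W})
  (N : set W) : linear_subspace N -> linear_subspace (f @^-1` N).
Proof.
move=> [N0 ND]; split=> [|k x y Nx Ny]; rewrite /preimage/= ?linear0//.
by rewrite linearP; exact: ND.
Qed.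

(* The vectors [v i] spanning modulo [N] need not lie in [f @` M], hence the
   induction exchanging them for vectors that do. *)
Lemma finite_codim_preimage {V W : lmodType K} (f : {linear V -> W})
    (M : set V) (N : set W) n (v : 'I_n -> W) :
  linear_subspace M -> linear_subspace N ->
  (forall x, M x -> exists c : 'I_n -> K, N (f x - \sum_(i < n) c i *: v i)) ->
  finite_codim M (f @^-1` N).
Proof.
elim: n v M => [|n IH] v M Ms Ns Mv.
  exists 0, (fun=> 0); split=> [[]//|x Mx]; exists (fun=> 0).
  have [c] := Mv x Mx.
  by rewrite !big_ord0 subr0 /preimage /= subr0.
pose v' i := v (lift ord0 i).
(* The elements of [M] whose image is spanned modulo [N] without [v ord0]; the induction hypothesis
   applies to them. *)
pose M' := M `&` [set x | exists c : 'I_n -> K,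
  N (f x - \sum_(i < n) c i *: v' i)].
have M's : linear_subspace M'.
  split.
    split; first exact: Ms.1.
    exists (fun=> 0); rewrite linear0 sub0r big1 ?oppr0; first exact: Ns.1.
    by move=> i _; rewrite scale0r.
  move=> k x y [Mx [c Nc]] [My [d Nd]]; split; first exact: Ms.2.
  exists (fun i => k * c i + d i).
  suff -> : f (k *: x + y) - \sum_(i < n) (k * c i + d i) *: v' i =
      k *: (f x - \sum_(i < n) c i *: v' i) + (f y - \sum_(i < n) d i *: v' i).
    exact: Ns.2.
  rewrite linearP scalerBr addrACA -opprD scaler_sumr -big_split/=.
  by under eq_bigr do rewrite scalerDl -scalerA.
have [m [u [Mu Nu]]] : finite_codim M' (f @^-1` N).
  by apply: (IH v') => // x [].
(* If [M'] is not all of [M], some [w] outside it involves [v ord0] with a non-zero coefficient and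
   is used in place of [v ord0]. *)
have [MM'|/existsNP[w /not_implyP[Mw nM'w]]] := pselect (M `<=` M').
  by exists m, u; split=> [i|x /MM']; [have [] := Mu i|exact: Nu].
have [cw Ncw] := Mv w Mw.
have cw0 : cw ord0 != 0.
  apply/eqP => c0; apply: nM'w; split=> //.
  exists (fun i => cw (lift ord0 i)).
  by move: Ncw; rewrite big_ord_recl c0 scale0r add0r.
exists m.+1, (fun i => if unlift ord0 i is Some j then u j else w); split.
  by move=> i; case: unliftP => [j _|_//]; have [] := Mu j.
move=> x Mx; have [cx Ncx] := Mv x Mx.
(* Subtracting [t *: w] cancels the coefficient of [v ord0]. *)
pose t := cx ord0 / cw ord0.
have M'xw : M' (x - t *: w).
  split; first by rewrite addrC -scaleNr; exact: Ms.2.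
  exists (fun i => cx (lift ord0 i) - t * cw (lift ord0 i)).
  have := Ns.2 (- t) _ _ Ncw Ncx; congr (N _).
  rewrite !big_ord_recl (linearB f) (linearZ_LR f)/=.
  have -> : \sum_(i < n) (cx (lift ord0 i) - t * cw (lift ord0 i)) *: v' i =
     \sum_(i < n) cx (lift ord0 i) *: v' i -
     t *: \sum_(i < n) cw (lift ord0 i) *: v' i.
    rewrite scaler_sumr -sumrB; apply: eq_bigr => i _.
    by rewrite scalerBl scalerA.
  rewrite scaleNr scalerBr scalerDr scalerA divfK//.
  rewrite !opprB opprD !addrA [LHS](ACl ((1*5)*4*3*2*6))/=.
  by rewrite subrr add0r.
have [c Nc] := Nu _ M'xw.
exists (fun i => if unlift ord0 i is Some j then c j else t).
rewrite big_ord_recl unlift_none opprD addrA.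
by under eq_bigr do rewrite liftK.
Qed.

Lemma finite_codimI {V : lmodType K} (M N N' : set V) :
  linear_subspace M -> linear_subspace N -> linear_subspace N' ->
  finite_codim M N -> finite_codim M N' -> finite_codim M (N `&` N').
Proof.
move=> Ms Ns N's [n [v [Mv Nv]]] [n' [v' [Mv' Nv']]].
have MNs := linear_subspaceI Ms Ns.
(* The vectors [v'] may lie outside [N]; the preimage under the identity exchanges them for vectors
   in both [M] and [N]. *)
have [m [w [MNw N'w]]] : finite_codim (M `&` N) (@idfun V @^-1` N').
  by apply: (finite_codim_preimage (v := v')) => // x [/Nv'].
exists (n + m)%N, (fun i : 'I_(n + m) =>
  match fintype.split i with inl j => v j | inr j => w j end).
split=> [i|x Mx]; first by case: fintype.split => j //; have [] := MNw j.
have [c Nc] := Nv x Mx.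
have [|d N'd] := N'w (x - \sum_(i < n) c i *: v i).
  by split=> //; apply: linear_subspaceB => //; exact: linear_subspace_sum.
exists (fun i : 'I_(n + m) =>
  match fintype.split i with inl j => c j | inr j => d j end).
rewrite big_split_ord/= opprD addrA.
under eq_bigr do rewrite (unsplitK (inl _)).
under [X in _ - X]eq_bigr do rewrite (unsplitK (inr _)).
split=> //; apply: linear_subspaceB => //.
by apply: linear_subspace_sum => // i; have [] := MNw i.
Qed.

Lemma finite_codim_forall {V : lmodType K} (M : set V) k (N : 'I_k -> set V) :
  linear_subspace M -> (forall i, linear_subspace (N i)) ->
  (forall i, finite_codim M (N i)) ->
  finite_codim M [set x | forall i, N i x].
Proof.
move=> Ms; elim: k N => [|k IH] N Ns Nf.
  by exists 0, (fun=> 0); split=> [[]//|x Mx]; exists (fun=> 0) => -[].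
have -> : [set x | forall i, N i x] =
    N ord0 `&` [set x | forall i, N (lift ord0 i) x].
  apply/seteqP; split=> [x Nx|x [N0x Nx] i]; first by split=> // i; exact: Nx.
  by have [j ->|->] := unliftP ord0 i; [exact: Nx|].
apply: finite_codimI => //; last exact: IH.
by split=> [i|c x y Nx Ny i]; [exact: (Ns _).1|apply: (Ns _).2].
Qed.

End finite_codimension.

(** * The Frattini radical of a Banach Lie algebra *)

Lemma closed_normed_set1 {K : numFieldType} {V : normedModType K} (x : V) :
  closed [set x].
Proof. exact/accessible_closed_set1/hausdorff_accessible/norm_hausdorff. Qed.

Section frattini.
Context {R : realType} {L : banachLieType R}.
Implicit Types M N V : set L.

Definition closed_subalgebra M := closed M /\ lie_subalgebra M.

Lemma closed_subalgebra0 M : closed_subalgebra M -> M 0.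
Proof. by case=> _ [[]]. Qed.

Lemma closed_subalgebraI M N :
  closed_subalgebra M -> closed_subalgebra N -> closed_subalgebra (M `&` N).
Proof.
move=> [Mc [Ms Ml]] [Nc [Ns Nl]]; split; first exact: closedI.
split; first exact: linear_subspaceI.
by move=> x y [Mx Nx] [My Ny]; split; [exact: Ml|exact: Nl].
Qed.

Lemma closed_subalgebra_bigcap (J : Type) (D : set J) (F : J -> set L) :
  (forall j, D j -> closed_subalgebra (F j)) ->
  closed_subalgebra (\bigcap_(j in D) F j).
Proof.
move=> DF; split; first by apply: closed_bigI => j /DF[].
split; first split.
- by move=> j /DF[_ [[]]].
- by move=> k x y Fx Fy j Dj; apply: (DF j Dj).2.1.2; [exact: Fx|exact: Fy].
- by move=> x y Fx Fy j Dj; apply: (DF j Dj).2.2; [exact: Fx|exact: Fy].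
Qed.

Lemma P_sub_closed_subalgebra M :
  closed_subalgebra M -> closed_subalgebra (P_sub M).
Proof.
move=> Ms; apply: closed_subalgebraI => //.
by apply: closed_subalgebra_bigcap => N [].
Qed.

(** The kernel of [phi] in [M] contains all brackets, so it is a closed subalgebra, of codimension
    at most one. Unless it is [M], it takes part in the intersection defining [P_sub M]. *)
Lemma P_sub_ker M (phi : L -> R[i]^o) : closed_subalgebra M ->
  linear phi -> continuous phi ->
  (forall x y, M x -> M y -> phi (lie x y) = 0) ->
  P_sub M `<=` phi @^-1` [set 0].
Proof.
move=> Ms phil phic phiM x [Mx PMx].
pose Phi : {linear L -> R[i]^o} :=
  HB.pack phi (GRing.isLinear.Build _ _ _ _ phi phil).
pose N := M `&` phi @^-1` [set 0].
have [NM|NM] := pselect (N = M); first by move: Mx; rewrite -NM => -[].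
suff /PMx[] : proper_fincodim_subalgebra M N by [].
have Ns : closed_subalgebra N.
  split.
    apply: closedI; first by case: Ms.
    apply: closed_comp => [y _|]; [exact: phic|exact: closed_normed_set1].
  split; last first.
    by move=> y z [My _] [Mz _]; split; [exact: Ms.2.2|exact: phiM].
  apply: linear_subspaceI; first exact: Ms.2.1.
  apply: (linear_subspace_preimage Phi).
  by split=> // k y z -> ->; rewrite scaler0 addr0.
split=> //; [by move=> y []|exact: Ns.1|exact: Ns.2|].
have [w Mw phiw] : exists2 w, M w & phi w != 0.
  apply: contra_notP NM => h; apply/seteqP; split=> [y []//|y My].
  by split=> //; apply: contra_notP h => /eqP ?; exists y.
exists 1%N, (fun=> w); split=> // y My; exists (fun=> phi y / phi w).
rewrite big_ord1; split; first by rewrite addrC -scaleNr; exact: Ms.2.1.2.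
change (Phi (y - (phi y / phi w) *: w) = 0).
by rewrite linearB linearZ_LR/= [_ *: _]divfK ?subrr.
Qed.

(** * Transfinite iteration of [P_sub] *)

Lemma well_order_ind (I : Type) (le : rel I) (Q : I -> Prop) :
  well_order le -> (forall a, (forall b, slt le b a -> Q b) -> Q a) ->
  forall a, Q a.
Proof.
move=> wo ind a; apply: contrapT => nQa.
have [|z [[/asboolP nQz zmin] _]] := wo (fun a => `[< ~ Q a >]).
  by exists a; apply/asboolP.
(* Reflexivity comes from the least element of a singleton. *)
have lexx b : le b b.
  have [|c [[/asboolP -> cmin] _]] := wo (fun x => `[< x = b >]).
    by exists b; apply/asboolP.
  by apply: cmin; apply/asboolP.
apply: nQz; apply: ind => b [bz b_neq]; apply: contrapT => nQb.
have zb : le z b by apply: zmin; apply/asboolP.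
(* Antisymmetry comes from uniqueness: [b] and [z] are both least in the pair they form. *)
have [|c [_ cuniq]] := wo (fun x => `[< x = b \/ x = z >]).
  by exists b; apply/asboolP; left.
have cb : c = b.
  by apply: cuniq; split=> [|_ /asboolP[->|->]] //; apply/asboolP; left.
apply: b_neq; rewrite -cb.
by apply: cuniq; split=> [|_ /asboolP[->|->]] //; apply/asboolP; right.
Qed.

(** Both properties pass to every term of the sequence by transfinite induction, whatever the index
    type. *)
Lemma P_stable_value_closed_subalgebra M V : closed_subalgebra M ->
  P_stable_value M V -> closed_subalgebra V /\ V `<=` M.
Proof.
move=> Ms [I [le [S [a [wo [S0 SS Slim] <- _]]]]].
move: a; apply: (well_order_ind wo) => b IH.
have [bfirst|nfirst] := pselect (is_first le b).
  by rewrite (S0 _ bfirst); split.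
have [[a ab]|nsucc] := pselect (exists a, is_succ le a b).
  have [Sas SaM] := IH a ab.1.
  rewrite (SS _ _ ab); split; first exact: P_sub_closed_subalgebra.
  by move=> x [/SaM].
rewrite Slim//; split; first by apply: closed_subalgebra_bigcap => a /IH[].
move/existsNP : nfirst => [a /contrapT ab] x Sx.
by apply: (IH a ab).2; exact: Sx.
Qed.

(** [nat] has no limit stage. It is long enough an index for a sequence that becomes stationary
    after two steps. *)
Lemma P_sequence_iter M : P_sequence M leq (fun n => iter n P_sub M).
Proof.
have succ n : is_succ leq n n.+1.
  split=> [|c [nc /eqP]]; first by split; [exact: leqnSn|elim: n => // n IH []].
  by rewrite ltn_neqAle nc andbT.
split.
- case=> // n /(_ n); case; exact: (succ n).1.
- move=> a b [[ab /eqP anb] bmin].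
  have -> // : b = a.+1.
  apply/eqP; rewrite eqn_leq ltn_neqAle anb ab bmin//; exact: (succ a).1.
- case=> [|n] [nfirst nsucc]; last by case: nsucc; exists n.
  by case: nfirst => -[|b] [].
Qed.

Lemma P_stable_value_iter M n :
  P_sub (iter n P_sub M) = iter n P_sub M ->
  P_stable_value M (iter n P_sub M).
Proof.
move=> Pn; exists nat, leq, (fun n => iter n P_sub M), n; split=> //.
  apply: antisymmetric_well_order; first exact: anti_leq.
  move=> A Ane; exists (ex_minn Ane).
  by case: ex_minnP => m Am mmin; split.
exact: P_sequence_iter.
Qed.

End frattini.

(** * The semidirect product over a generated algebra *)

Section operator_algebra.
Context {R : realType} {X : completeNormedModType R[i]}.
Implicit Types (T f g : bop X) (A S : set (bop X)) (x y : X).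

Lemma bop_eval_continuous x : continuous (fun f : bop X => f x).
Proof.
pose e f := f x; have el : linear e by [].
pose E : {linear bop X -> X} := HB.pack e (GRing.isLinear.Build _ _ _ _ e el).
apply: (@bounded_linear_continuous _ _ _ E); apply/linear_boundedP.
near=> r => f /=; rewrite (le_trans (opnorm_ler f x))// [leLHS]mulrC.
apply: ler_wpM2r; first exact: opnorm_ge0.
by near: r; apply: nbhs_pinfty_ge; exact: normr_real.
Unshelve. all: by end_near. Qed.

Definition commutant S : set (bop X) :=
  [set f | forall g, S g -> bop_comp f g = bop_comp g f].

(** Evaluation at a point is continuous, so commuting with [g] at [x] is a closed condition. *)
Lemma closed_commutant S : closed (commutant S).
Proof.
have -> : commutant S = \bigcap_(gx in S `*` setT)
    ((fun f : bop X => f (gx.1 gx.2) - gx.1 (f gx.2)) @^-1` [set 0]).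
  apply/seteqP; split=> [f fS [g x] [/= Sg _]|f fS g Sg].
    by apply/eqP; rewrite subr_eq0 -[f _]/(bop_comp f g x) fS.
  by apply/bopP => x; apply/eqP; rewrite -subr_eq0; exact/eqP/(fS (g, x)).
apply: closed_bigI => -[g x] _.
apply: closed_comp => [f _|]; last exact: closed_normed_set1.
apply: (@cvgB _ _ _ (nbhs f)); first exact: bop_eval_continuous.
apply: (@continuous_comp _ _ _ (fun f : bop X => f x) g).
  exact: bop_eval_continuous.
exact: bop_continuous.
Qed.

Lemma commutant_subalgebra S : op_subalgebra (commutant S).
Proof.
split; first split.
- by move=> g Sg; apply/bopP => x /=; rewrite linear0.
- move=> k f h fS hS g Sg; apply/bopP => x.
  have := congr1 (fun a : bop X => a x) (fS g Sg).
  have := congr1 (fun a : bop X => a x) (hS g Sg).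
  rewrite /= => hg fg; change (k *: f (g x) + h (g x) = g (k *: f x + h x)).
  by rewrite linearP fg hg.
- move=> f h fS hS g Sg; apply/bopP => x.
  have := congr1 (fun a : bop X => a (h x)) (fS g Sg).
  have := congr1 (fun a : bop X => a x) (hS g Sg).
  by rewrite /= => -> ->.
Qed.

(** Commutants are closed subalgebras. That of [T] contains the generated algebra, so [T] lies in
    the commutant of this algebra, which therefore contains the algebra too. *)
Lemma generated_algebra_commutes T f g :
  generated_algebra T f -> generated_algebra T g ->
  bop_comp f g = bop_comp g f.
Proof.
have sub S : commutant S T -> generated_algebra T `<=` commutant S.
  move=> ST h; apply; split; last by move=> _ ->.
  split; [exact: closed_commutant|exact: commutant_subalgebra].
move=> Tf; apply: (sub _ _ _ Tf) => h Th; apply/esym.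
by apply: (sub [set T] _ _ Th) => // _ ->.
Qed.

End operator_algebra.

Section semidirect_frattini.
Context {R : realType} {X : completeNormedModType R[i]}.
Implicit Types (T f g : bop X) (x y : X) (V : set (semidirect X)).

Lemma generated_algebra_gen T : generated_algebra T T.
Proof. by move=> A [_]; exact. Qed.

Lemma closed_subalgebra_generated T :
  closed_subalgebra (semidirect_over (generated_algebra T)).
Proof.
split.
  apply: closed_semidirect_over; exact: generated_algebra_closed.
apply: lie_subalgebra_semidirect_over; exact: generated_algebra_subalgebra.
Qed.

(** By commutativity, brackets in [V] have zero first component. A general [V] is allowed so that
    the lemma also covers an arbitrary stable value. *)
Lemma P_sub_fst0 T V : closed_subalgebra V ->
  V `<=` semidirect_over (generated_algebra T) ->
  P_sub V `<=` [set u | u.1 = 0].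
Proof.
move=> Vs VT u PVu; apply/eqP; apply: contrapT => /negP u1.
have [phi [phic]] := functional_separation u1.
rewrite (_ : phi u.1 = 0) ?eqxx//.
apply: (P_sub_ker Vs (phi := fun w : semidirect X => phi w.1)) PVu.
- by move=> k w z; rewrite -linearP.
- by move=> w; apply: continuous_comp; [exact: cvg_fst|exact: phic].
- move=> w z /VT Tw /VT Tz.
  by rewrite /= (generated_algebra_commutes Tw Tz) subrr linear0.
Qed.

Lemma P_sub_snd0 V : closed_subalgebra V -> V `<=` [set u | u.1 = 0] ->
  P_sub V `<=` [set 0].
Proof.
move=> Vs V1 u PVu.
have u1 : u.1 = 0 by apply: V1; case: PVu.
suff u2 : u.2 = 0 by case: (u) u1 u2 => /= ? ? -> ->.
apply/eqP; apply: contrapT => /negP u2.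
have [phi [phic]] := functional_separation u2.
rewrite (_ : phi u.2 = 0) ?eqxx//.
apply: (P_sub_ker Vs (phi := fun w : semidirect X => phi w.2)) PVu.
- by move=> k w z; rewrite -linearP.
- by move=> w; apply: continuous_comp; [exact: cvg_snd|exact: phic].
- by move=> w z /V1/= w1 /V1/= z1; rewrite /= w1 z1 subrr linear0.
Qed.

Lemma Frattini_radical_generated T :
  Frattini_radical (semidirect_over (generated_algebra T)) = [set 0].
Proof.
set L := semidirect_over _.
have Ls : closed_subalgebra L := closed_subalgebra_generated T.
have PLs := P_sub_closed_subalgebra Ls.
have PLT : P_sub L `<=` [set u | u.1 = 0].
  exact: (P_sub_fst0 Ls (@subset_refl _ L)).
have P0 : P_sub [set (0 : semidirect X)] = [set 0].
  by apply/seteqP; split=> [x []//|x ->]; split=> // N [_ _ _ [[]]].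
have PPL : P_sub (P_sub L) = [set 0].
  apply/seteqP; split; first exact: P_sub_snd0.
  by move=> _ ->; apply: closed_subalgebra0; exact: P_sub_closed_subalgebra.
apply: xget_unique.
  by rewrite -PPL; apply: (P_stable_value_iter (n := 2)); rewrite /= PPL P0.
(* Uniqueness: a stable [V] equals [P_sub V], so the two vanishing lemmas apply to [V] itself. *)
move=> V LV; have [Vs VL] := P_stable_value_closed_subalgebra Ls LV.
have PV : P_sub V = V by case: LV => ? [? [? [? []]]].
have V1 : V `<=` [set u | u.1 = 0] by rewrite -{1}PV; exact: (P_sub_fst0 Vs VL).
apply/seteqP; split; last by move=> _ ->; exact: closed_subalgebra0.
by rewrite -{1}PV; exact: P_sub_snd0.
Qed.

(** * Invariant subspaces inside subalgebras of finite codimension *)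

Definition semidirect_inr x : semidirect X := (0, x).

Lemma semidirect_inr_linear : linear semidirect_inr.
Proof. by move=> k x y; congr pair; rewrite /= scaler0 addr0. Qed.

HB.instance Definition _ :=
  GRing.isLinear.Build R[i] X (semidirect X) _ semidirect_inr
    semidirect_inr_linear.

Lemma semidirect_inr_continuous : continuous semidirect_inr.
Proof.
move=> x; have h0 : (fun=> 0 : bop X) @ nbhs x --> nbhs (0 : bop X).
  exact: cvg_cst.
exact: cvg_pair h0 cvg_id.
Qed.

Lemma fincodim_subalgebra_Lat T (N : set (semidirect X)) :
  proper_fincodim_subalgebra (semidirect_over (generated_algebra T)) N ->
  exists2 Y, Lat_fincodim T Y & Y `<=` semidirect_inr @^-1` N.
Proof.
move=> [NL _ Nc [Ns Nl] [n [v [Lv Nv]]]].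
have [[A0 AD] AM] := generated_algebra_subalgebra T.
pose a i := (v i).1; pose Y := semidirect_inr @^-1` N.
have Ys : linear_subspace Y by exact: linear_subspace_preimage.
have YA g y : generated_algebra T g -> Y y -> (forall i, Y (a i y)) -> Y (g y).
  move=> Tg Yy Yay; have [|c Nc'] := Nv (g, 0); first exact: Tg.
  set w := _ - _ in Nc'.
  (* The bracket of [w] with [(0, y)] is [(0, w.1 y)], whatever the second component of [w]. *)
  have Yw : Y (w.1 y).
    have := Nl _ _ Nc' Yy; congr (N _); congr pair.
      by apply/bopP => x; change (w.1 0 - 0 = 0); rewrite linear0 subrr.
    by rewrite /= subr0.
  pose e (u : semidirect X) := u.1 y; have el : linear e by [].
  pose E : {linear semidirect X -> X} :=
    HB.pack e (GRing.isLinear.Build _ _ _ _ e el).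
  have -> : g y = w.1 y + \sum_(i < n) c i *: a i y.
    rewrite -[w.1 y]/(E w) linearB linear_sum.
    by under eq_bigr do rewrite linearZ_LR; rewrite subrK.
  rewrite -[w.1 y]scale1r; apply: Ys.2 => //.
  exact: linear_subspace_sum.
exists (Y `&` [set y | forall i, Y (a i y)]); last by move=> y [].
have Yc : closed Y.
  apply: closed_comp => // x _; exact: semidirect_inr_continuous.
have Yf : finite_codim setT Y.
  apply: (finite_codim_preimage (v := v)) => // x _.
  by apply: Nv; exact: A0.
have as_ i : linear_subspace (a i @^-1` Y) by exact: linear_subspace_preimage.
have Zs : linear_subspace [set y | forall i, Y (a i y)].
  split=> [i|k x y hx hy i]; first exact: (as_ i).1.
  exact: (as_ i).2 _ _ _ (hx i) (hy i).
split; first split.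
- apply: closedI => //.
  rewrite (_ : mkset _ = \bigcap_i (a i @^-1` Y)); last first.
    by apply/seteqP; split=> y h i; [move=> _; exact: h|exact: (h i I)].
  apply: closed_bigI => i _; apply: closed_comp => // x _.
  exact: bop_continuous.
- exact: linear_subspaceI.
- have TT : generated_algebra T T by exact: generated_algebra_gen.
  move=> y [Yy Yay]; split=> [|i]; first exact: YA _ _ TT Yy Yay.
  (* The composite of [a i] and [T] is in the algebra, so it too maps [y] into [Y]. *)
  by apply: (YA (bop_comp (a i) T) y) => //; apply: AM => //; exact: Lv.
- apply: finite_codimI => //; apply: finite_codim_forall => // i.
  have [m [u [_ Yu]]] := Yf.
  by apply: (finite_codim_preimage (f := a i) (v := u)) => // x _; exact: Yu.
Qed.

End semidirect_frattini.

Theorem theorem7p19 (R : realType) (X : completeNormedModType R[i])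
    (T : bop X)
    (chain : total_on (Lat_fincodim T) subset)
    (Xomega_neq0 : \bigcap_(Y in Lat_fincodim T) Y <> [set 0]) :
  let L : set (semidirect X) := semidirect_over (generated_algebra T) in
  P_sub L <> Frattini_radical L /\ Frattini_radical L = [set 0].
Proof.
move=> L; rewrite Frattini_radical_generated; split=> // PL0.
(* If [P_sub L] were zero, each [z] in the intersection would give [(0, z)] in [P_sub L], hence
   [z = 0]. *)
apply: Xomega_neq0; apply/seteqP; split=> [z Xz|_ -> Y [[_ []]]//].
suff : P_sub L (semidirect_inr z) by rewrite PL0 => -[].
split; first exact: (generated_algebra_subalgebra T).1.1.
by move=> N /fincodim_subalgebra_Lat[Y LY]; apply; exact: Xz.
Qed.
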